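(* The $\kappa$-entanglement measure is not generally convex. That is, there exist finite-dimensional Hilbert spaces $\mathcal{H}_A,\mathcal{H}_B$, a finite probability distribution $p(z)$, and bipartite states $\{\rho^z_{AB}\}_z$ on $\mathcal{H}_A\otimes\mathcal{H}_B$ such that, with $\overline{\rho}_{AB}:=\sum_z p(z)\rho^z_{AB}$, $$E_\kappa(\overline{\rho}_{AB})>\sum_z p(z)E_\kappa(\rho^z_{AB}).$$
   Context: A bipartite state $\rho_{AB}$ is a positive semi-definite operator of unit trace on $\mathcal{H}_A\otimes\mathcal{H}_B$. The partial transpose with respect to a fixed orthonormal basis $\{|i\rangle_B\}_i$ is the linear map $T_B(X_{AB})=X_{AB}^{T_B}:=\sum_{i,j}(I_A\otimes|i\rangle\langle j|_B)X_{AB}(I_A\otimes|i\rangle\langle j|_B)$. $\kappa$-entanglement: $E_\kappa(\rho_{AB}):=\inf\{\log_2\operatorname{Tr}[S_{AB}]: S_{AB}\ge0,\ -S_{AB}^{T_B}\le\rho_{AB}^{T_B}\le S_{AB}^{T_B}\}$. An entanglement measure $E$ is convex if $E(\sum_z p(z)\rho^z_{AB})\le\sum_z p(z)E(\rho^z_{AB})$ for all probability distributions $p$ and states $\rho^z_{AB}$. *)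

(* Defs.v *)
From mathcomp Require Import all_boot all_order all_algebra.
From mathcomp Require Import complex mxtens.
From mathcomp Require Import all_classical all_reals all_analysis.

Set Implicit Arguments.
Unset Strict Implicit.
Unset Printing Implicit Defensive.

Import Order.TTheory GRing.Theory Num.Theory.

Local Open Scope classical_set_scope.
Local Open Scope complex_scope.
Local Open Scope sesquilinear_scope.
Local Open Scope ring_scope.

(* The Hilbert spaces are H_A = C^dA and H_B = C^dB with C = R[i]; an operator
   on H_A (x) H_B is a matrix of size dA * dB, indexed so that the tensor
   product of operators is the Kronecker product *t of mxtens. *)

Definition psdmx (R : realType) (n : nat) (M : 'M[R[i]]_n) : Prop :=
  M \is hermsymmx /\ forall v : 'cV[R[i]]_n, 0 <= (v ^t* *m M *m v) 0 0.

Definition lemx_psd (R : realType) (n : nat) (M N : 'M[R[i]]_n) : Prop :=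
  psdmx (N - M).

Definition is_state (R : realType) (n : nat) (rho : 'M[R[i]]_n) : Prop :=
  psdmx rho /\ \tr rho = 1.

(* The fixed orthonormal basis of H_B is the standard one, so that
   delta_mx i j = |i><j|. *)
Definition ptransB (R : realType) (dA dB : nat) (X : 'M[R[i]]_(dA * dB)) :
    'M[R[i]]_(dA * dB) :=
  \sum_(i < dB) \sum_(j < dB)
    ((1%:M : 'M[R[i]]_dA) *t (delta_mx i j : 'M[R[i]]_dB)) *m X *m
    ((1%:M : 'M[R[i]]_dA) *t (delta_mx i j : 'M[R[i]]_dB)).

Definition log2 (R : realType) (x : R) : R := ln x / ln 2.

Definition kappa_feasible (R : realType) (dA dB : nat)
    (rho : 'M[R[i]]_(dA * dB)) : set 'M[R[i]]_(dA * dB) :=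
  [set S | [/\ psdmx S,
               lemx_psd (- ptransB S) (ptransB rho) &
               lemx_psd (ptransB rho) (ptransB S)]].

(* \tr S is real since S is positive semi-definite. If rho is a state and S is
   feasible, then Re (\tr S) >= 1, because ptransB preserves the trace; the
   convention ln x = 0 for x <= 0 therefore plays no role. *)
Definition E_kappa (R : realType) (dA dB : nat)
    (rho : 'M[R[i]]_(dA * dB)) : \bar R :=
  ereal_inf [set (log2 (complex.Re (\tr S)))%:E | S in kappa_feasible rho].

(* Main.v *)
(* Mix the maximally entangled two-qubit state bell/2 and its dephasing
   dephased_bell/2 with equal weights. The partial transpose of bell is the swap
   F, and -1 <= F <= 1, so S = 1/2 gives E_kappa(bell/2) <= log2 2 = 1; the
   dephased state is its own partial transpose, so it is feasible for itself and
   its E_kappa is at most log2 1 = 0. The convex combination of the two values is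
   thus at most 1/2. The partial transpose N of the mixture has diagonal entries
   1/2, 0, 0, 1/2 and entries 1/4 at (01,10) and (10,01).
   If M is the partial transpose of a feasible S, testing M - N on e00, e11 and
   e01 + e10, and M + N on e01 - e10, yields Tr S = Tr M >= 3/2, and
   log2 (3/2) > 1/2 because (3/2)^2 > 2. *)
Require Import Defs.
From mathcomp Require Import all_boot all_order all_algebra.
From mathcomp Require Import complex mxtens.
From mathcomp Require Import all_classical all_reals all_analysis.
From mathcomp Require Import ring lra.

Import Order.TTheory GRing.Theory Num.Theory.

Local Open Scope complex_scope.
Local Open Scope sesquilinear_scope.
Local Open Scope ring_scope.

(** * Entries, linearity and trace of the partial transpose *)

Lemma ptransBE (R : realType) (dA dB : nat) (X : 'M[R[i]]_(dA * dB)) a b c e :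
  ptransB X (mxtens_index (a, b)) (mxtens_index (c, e)) =
  X (mxtens_index (a, e)) (mxtens_index (c, b)).
Proof.
pose D (i j : 'I_dB) : 'M[R[i]]_(dA * dB) := 1%:M *t delta_mx i j.
have DE i j k l : D i j (mxtens_index k) (mxtens_index l) =
    ((k == (l.1, i)) && (l.2 == j))%:R.
  case: k l => [k1 k2] [l1 l2]; rewrite tensmxE !mxE -natrM mulnb xpair_eqE /=.
  by rewrite andbA.
rewrite /ptransB summxE (bigD1 b) //= summxE (bigD1 e) //=.
(* The left factor forces the row index [b] to be [i], the right one forces the column index [e] to
   be [j]; so of the double sum only the term [D b e *m X *m D b e] survives. *)
have E i j : (D i j *m X *m D i j) (mxtens_index (a, b)) (mxtens_index (c, e)) =
    ((b == i) && (e == j))%:R * X (mxtens_index (a, j)) (mxtens_index (c, i)).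
  rewrite !mxE (bigD1 (mxtens_index (c, i))) //= big1 ?addr0 => [|m].
    rewrite mxE (bigD1 (mxtens_index (a, j))) //= big1 ?addr0 => [|m].
      rewrite !DE /= !xpair_eqE !eqxx /= andbT.
      by case: (b == i); case: (e == j); rewrite ?mul0r ?mulr0 ?mul1r ?mulr1.
    case: (mxtens_indexP m) => m1 m2 /eqP nm; rewrite DE /= xpair_eqE /=.
    case: eqP => [am|] /=; last by rewrite mul0r.
    case: eqP => _ /=; last by rewrite mul0r.
    by case: eqP => [mj|]; rewrite ?mul0r //; case: nm; rewrite am mj.
  case: (mxtens_indexP m) => m1 m2 nm; rewrite DE /=.
  case: eqP => [cm|] /=; last by rewrite mulr0.
  by case/negP: nm; rewrite cm.
rewrite -/(D b e).
rewrite E !eqxx mul1r /= big1 => [|j jNe]; last first.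
  by rewrite E eqxx eq_sym (negPf jNe) mul0r.
rewrite big1 ?addr0 // => i iNb; rewrite summxE big1 // => j _.
by rewrite E eq_sym (negPf iNb) mul0r.
Qed.

Lemma ptransBD (R : realType) (dA dB : nat) (X Y : 'M[R[i]]_(dA * dB)) :
  ptransB (X + Y) = ptransB X + ptransB Y.
Proof.
apply/matrixP => k l.
case: (mxtens_indexP k) => a b; case: (mxtens_indexP l) => a' b'.
by rewrite !(mxE, ptransBE).
Qed.

Lemma ptransBZ (R : realType) (dA dB : nat) (c : R[i])
    (X : 'M[R[i]]_(dA * dB)) : ptransB (c *: X) = c *: ptransB X.
Proof.
apply/matrixP => k l.
case: (mxtens_indexP k) => a b; case: (mxtens_indexP l) => a' b'.
by rewrite !(mxE, ptransBE).
Qed.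

Lemma mxtrace_ptransB (R : realType) (dA dB : nat) (X : 'M[R[i]]_(dA * dB)) :
  \tr (ptransB X) = \tr X.
Proof.
by apply: eq_bigr => k _; case: (mxtens_indexP k) => a b; rewrite ptransBE.
Qed.

(* A Hermitian [M] with [M^2 = c M] satisfies [v^* M v = c^-1 |M v|^2]. *)
Lemma psdmx_idem (R : realType) (n : nat) (c : R[i]) (M : 'M[R[i]]_n) :
  0 < c -> M \is hermsymmx -> M *m M = c *: M -> psdmx M.
Proof.
move=> c0 Mh MM; split=> // v.
have Mt : M ^t* = M by move/is_hermitianmxP: Mh; rewrite expr0 scale1r => <-.
have -> : v ^t* *m M *m v = c^-1 *: ((M *m v) ^t* *m (M *m v)).
  rewrite trmx_mul map_mxM /= Mt mulmxA -[v ^t* *m M *m M]mulmxA MM.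
  by rewrite -scalemxAr -scalemxAl scalerA mulVf ?scale1r ?gt_eqF.
rewrite mxE mulr_ge0 ?invr_ge0 ?(ltW c0) // mxE sumr_ge0 // => k _.
by rewrite !mxE mulrC mul_conjC_ge0.
Qed.

Lemma psdmx_diag_ge0 (R : realType) (n : nat) (M : 'M[R[i]]_n) i :
  psdmx M -> 0 <= M i i.
Proof.
move=> [_ /(_ (delta_mx i 0))].
by rewrite trmx_delta map_delta_mx -rowE -colE !mxE.
Qed.

(** The quadratic form is tested on e_i + (-1)^s e_j; the two signs of the cross terms let them
    cancel later. *)
Lemma psdmx_pair_ge0 (R : realType) (n : nat) (M : 'M[R[i]]_n) (s : bool) i j :
  psdmx M -> 0 <= M i i + M j j + (-1) ^+ s * (M i j + M j i).
Proof.
move=> [_ /(_ (delta_mx i 0 + (-1) ^+ s *: delta_mx j 0))].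
rewrite [(_ + _)^T]linearD /= [(_ *: _)^T]linearZ /= map_mxD map_mxZ /= rmorphXn rmorphN1.
rewrite !trmx_delta !map_delta_mx !mulmxDl !mulmxDr -!scalemxAl -!scalemxAr.
rewrite -!rowE -!colE !mxE; congr (0 <= _).
by case: s; rewrite ?expr0 ?expr1; ring.
Qed.

(** * The unnormalised Bell operator, its dephasing and the swap *)

Definition bell (R : realType) : 'M[R[i]]_(2 * 2) :=
  \matrix_(k, l) (((mxtens_unindex k).1 == (mxtens_unindex k).2)
                  && ((mxtens_unindex l).1 == (mxtens_unindex l).2))%:R.

Definition dephased_bell (R : realType) : 'M[R[i]]_(2 * 2) :=
  \matrix_(k, l) ((k == l)
                  && ((mxtens_unindex k).1 == (mxtens_unindex k).2))%:R.

Definition swapmx (R : realType) : 'M[R[i]]_(2 * 2) :=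
  \matrix_(k, l) (((mxtens_unindex k).1 == (mxtens_unindex l).2)
                  && ((mxtens_unindex k).2 == (mxtens_unindex l).1))%:R.

Lemma ptransB_bell (R : realType) : ptransB (bell R) = swapmx R.
Proof.
apply/matrixP => k l.
case: (mxtens_indexP k) => a b; case: (mxtens_indexP l) => a' b'.
by rewrite ptransBE !mxE !mxtens_indexK /= [b == _]eq_sym.
Qed.

(** Transposing the second factor fixes every matrix that is diagonal in the product basis. *)
Lemma ptransB_dephased_bell (R : realType) :
  ptransB (dephased_bell R) = dephased_bell R.
Proof.
apply/matrixP => k l.
case: (mxtens_indexP k) => a b; case: (mxtens_indexP l) => a' b'.
rewrite ptransBE !mxE !(can_eq (@mxtens_indexK _ _)) !mxtens_indexK /= !xpair_eqE.
case: (a =P a') => //= ->; rewrite [b == _]eq_sym.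
by case: eqP => // ->.
Qed.

Lemma ptransB1 (R : realType) (dA dB : nat) :
  ptransB (1%:M : 'M[R[i]]_(dA * dB)) = 1%:M.
Proof.
apply/matrixP => k l.
case: (mxtens_indexP k) => a b; case: (mxtens_indexP l) => a' b'.
rewrite ptransBE !mxE !(can_eq (@mxtens_indexK _ _)) !xpair_eqE.
by rewrite [b == _]eq_sym.
Qed.

(** At concrete indices [mxtens_unindex] computes, so each of the sixteen entries becomes a ring
    identity. *)
Ltac entrywise_4 :=
  apply/matrixP => -[[|[|[|[|//]]]] ?] [[|[|[|[|//]]]] ?];
  rewrite !(mxE, big_ord_recl, big_ord0) /=; ring.

(** [bell] is |phi><phi| for phi = |00> + |11>, whose squared norm is 2. *)
Lemma bell_sqr (R : realType) : bell R *m bell R = 2 *: bell R.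
Proof. entrywise_4. Qed.

(** This is the projection |00><00| + |11><11|; the factor 1 matches the hypothesis of
    [psdmx_idem]. *)
Lemma dephased_bell_sqr (R : realType) :
  dephased_bell R *m dephased_bell R = 1 *: dephased_bell R.
Proof. entrywise_4. Qed.

Lemma swapmx_sqr (R : realType) : swapmx R *m swapmx R = 1%:M.
Proof. entrywise_4. Qed.

Lemma psdmxZ (R : realType) (n : nat) (c : R[i]) (M : 'M[R[i]]_n) :
  0 <= c -> psdmx M -> psdmx (c *: M).
Proof.
move=> c0 [/is_hermitianmxP + Mge0]; rewrite expr0 scale1r => Mh; split.
  apply/is_hermitianmxP; rewrite expr0 scale1r linearZ /= map_mxZ -Mh.
  by rewrite /= conj_Creal ?ger0_real.
by move=> v; rewrite -scalemxAr -scalemxAl mxE mulr_ge0.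
Qed.

Lemma psdmx0 (R : realType) (n : nat) : psdmx (0 : 'M[R[i]]_n).
Proof.
split=> [|v]; last by rewrite mulmx0 mul0mx mxE.
by apply/is_hermitianmxP; rewrite trmx0 map_mx0 scaler0.
Qed.

Lemma psdmx1 (R : realType) (n : nat) : psdmx (1%:M : 'M[R[i]]_n).
Proof.
apply: (psdmx_idem _ _ 1) => //; last by rewrite mulmx1 scale1r.
by apply/is_hermitianmxP; rewrite trmx1 map_mx1 scale1r.
Qed.

Lemma bell_psd (R : realType) : psdmx (bell R).
Proof.
apply: (psdmx_idem _ _ 2 _ _ _ (bell_sqr R)) => //.
apply: realsym_hermsym; last by apply/mxOverP => k l; rewrite mxE realn.
apply/is_hermitianmxP; rewrite expr0 scale1r map_mx_id //.
by apply/matrixP => k l; rewrite !mxE andbC.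
Qed.

Lemma dephased_bell_psd (R : realType) : psdmx (dephased_bell R).
Proof.
apply: (psdmx_idem _ _ 1 _ _ _ (dephased_bell_sqr R)) => //.
apply: realsym_hermsym; last by apply/mxOverP => k l; rewrite mxE realn.
apply/is_hermitianmxP; rewrite expr0 scale1r map_mx_id //.
by apply/matrixP => k l; rewrite !mxE eq_sym; case: eqP => // ->.
Qed.

Lemma swapmx_hermsym (R : realType) : swapmx R \is hermsymmx.
Proof.
apply: realsym_hermsym; last by apply/mxOverP => k l; rewrite mxE realn.
apply/is_hermitianmxP; rewrite expr0 scale1r map_mx_id //.
by apply/matrixP => k l; rewrite !mxE andbC eq_sym [_ == _.1]eq_sym.
Qed.

(** Since F^2 = 1, the square of 1 + F or 1 - F is twice itself, so [psdmx_idem] applies with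
    constant 2. For the swap this gives -1 <= F <= 1. *)
Lemma psdmx_1D_involution (R : realType) (n : nat) (s : bool) (F : 'M[R[i]]_n) :
  F \is hermsymmx -> F *m F = 1%:M -> psdmx (1%:M + (-1) ^+ s *: F).
Proof.
move=> /is_hermitianmxP + FF; rewrite expr0 scale1r => Fh.
apply: (psdmx_idem _ _ 2) => //.
  apply/is_hermitianmxP; rewrite expr0 scale1r linearD linearZ /=.
  by rewrite map_mxD map_mxZ /= -Fh trmx1 map_mx1 rmorphXn /= rmorphN1.
rewrite mulmxDl !mulmxDr !mul1mx mulmx1 -scalemxAl -scalemxAr scalerA FF.
rewrite -signr_addb addbb expr0 scale1r.
by rewrite addrC [_ *: F + _]addrC scaler_nat mulr2n.
Qed.

(** * Upper bounds for the two components *)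

Lemma E_kappa_le (R : realType) (dA dB : nat) (rho S : 'M[R[i]]_(dA * dB)) :
  kappa_feasible rho S -> (E_kappa rho <= (log2 (complex.Re (\tr S)))%:E)%E.
Proof. by move=> Sf; apply: ge_ereal_inf; eexists; [exists S|]. Qed.

Lemma mxtrace_bell (R : realType) : \tr (bell R) = 2.
Proof. by rewrite /mxtrace !big_ord_recl big_ord0 !mxE /= !add0r addr0 -natrD. Qed.

Lemma mxtrace_dephased_bell (R : realType) : \tr (dephased_bell R) = 2.
Proof. by rewrite /mxtrace !big_ord_recl big_ord0 !mxE /= !add0r addr0 -natrD. Qed.

Lemma E_kappa_bell (R : realType) : (E_kappa (2^-1 *: bell R) <= 1%:E)%E.
Proof.
have c0 : 0 <= 2^-1 :> R[i] by rewrite invr_ge0 ler0n.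
have -> : (1%:E = (log2 (complex.Re (\tr (2^-1 *: 1%:M : 'M[R[i]]_(2 * 2)))))%:E)%E.
  rewrite mxtraceZ mxtrace1 natrM mulrA mulVf ?pnatr_eq0 // mul1r raddfMn /=.
  by rewrite /log2 divff // gt_eqF // ln_gt0 // ltr1n.
apply: E_kappa_le; split; rewrite /lemx_psd ?ptransBZ ?ptransB1 ?ptransB_bell.
- by apply: psdmxZ => //; exact: psdmx1.
(* The two remaining constraints are the positivity of (1 + F)/2 and of (1 - F)/2. *)
- rewrite opprK addrC -scalerDr; apply: psdmxZ => //.
  by have := psdmx_1D_involution R _ false _ (swapmx_hermsym R) (swapmx_sqr R);
     rewrite expr0 scale1r.
- rewrite -scalerBr; apply: psdmxZ => //.
  by have := psdmx_1D_involution R _ true _ (swapmx_hermsym R) (swapmx_sqr R);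
     rewrite expr1 scaleN1r.
Qed.

Lemma E_kappa_dephased_bell (R : realType) :
  (E_kappa (2^-1 *: dephased_bell R) <= 0)%E.
Proof.
have c0 : 0 <= 2^-1 :> R[i] by rewrite invr_ge0 ler0n.
have -> : (0 = (log2 (complex.Re (\tr (2^-1 *: dephased_bell R))))%:E)%E.
  by rewrite mxtraceZ mxtrace_dephased_bell mulVf ?pnatr_eq0 //= /log2 ln1 mul0r.
apply: E_kappa_le; split; rewrite /lemx_psd ?ptransBZ ?ptransB_dephased_bell.
- by apply: psdmxZ => //; exact: dephased_bell_psd.
- rewrite opprK -scalerDr -mulr2n -[dephased_bell R *+ 2]scaler_nat.
  apply: psdmxZ => //; apply: psdmxZ; first exact: ler0n.
  exact: dephased_bell_psd.
- by rewrite subrr; exact: psdmx0.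
Qed.

(** * Lower bound for the mixture *)

Lemma kappa_feasible_mixture (R : realType) (S : 'M[R[i]]_(2 * 2)) :
  kappa_feasible (4^-1 *: (bell R + dephased_bell R)) S ->
  3 / 2 <= complex.Re (\tr S).
Proof.
rewrite /kappa_feasible /= => -[_].
rewrite /lemx_psd opprK -mxtrace_ptransB; set M := ptransB S.
have -> : ptransB (4^-1 *: (bell R + dephased_bell R)) =
    4^-1 *: (swapmx R + dephased_bell R).
  by rewrite ptransBZ ptransBD ptransB_bell ptransB_dephased_bell.
set N := 4^-1 *: _ => NM MN.
pose i00 := @mxtens_index 2 2 (0, 0); pose i01 := @mxtens_index 2 2 (0, 1).
pose i10 := @mxtens_index 2 2 (1, 0); pose i11 := @mxtens_index 2 2 (1, 1).
have trM : \tr M = M i00 i00 + M i01 i01 + M i10 i10 + M i11 i11.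
  rewrite /mxtrace !big_ord_recl big_ord0 addr0 !addrA.
  by congr (M _ _ + M _ _ + M _ _ + M _ _); apply: val_inj.
have := psdmx_diag_ge0 _ _ _ i00 MN; have := psdmx_diag_ge0 _ _ _ i11 MN.
have := psdmx_pair_ge0 _ _ _ false i01 i10 MN.
have := psdmx_pair_ge0 _ _ _ true i01 i10 NM.
rewrite expr0 expr1 !mxE !mxtens_indexK !(can_eq (@mxtens_indexK _ _)) /=.
move=> NM01 MN01 MN11 MN00.
(* The order on [R[i]] asks for equal imaginary parts and ordered real parts; the second half is
   what is wanted. *)
suff : (3 / 2)%:C <= \tr M by rewrite lecE => /andP[].
rewrite trM rmorphM /= fmorphV !rmorph_nat -subr_ge0.
(* Adding the tests on e01 + e10 and e01 - e10 cancels the off-diagonal entries of [M] but counts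
   [M i01 i01 + M i10 i10] twice. Hence the inequality is doubled and the tests on e00 and e11 are
   taken twice. *)
rewrite -(@pmulr_rge0 _ 2) ?ltr0n //.
have diag_ge0 := addr_ge0 MN11 MN00.
have := addr_ge0 (addr_ge0 NM01 MN01) (addr_ge0 diag_ge0 diag_ge0).
by congr (0 <= _); field.
Qed.

Lemma half_lt_log2_3half (R : realType) : 2^-1 < log2 (3 / 2) :> R.
Proof.
have ln2 : 0 < ln 2 :> R by rewrite ln_gt0 // ltr1n.
have : ln 2 < ln ((3 / 2) ^+ 2) :> R by rewrite ltr_ln ?posrE ?exprn_gt0 //; lra.
by rewrite lnXn // -[ln _ *+ 2]mulr_natl -ltr_pdivrMl // /log2 ltr_pdivlMr.
Qed.

Theorem proposition11 (R : realType) :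
  exists (dA dB n : nat) (p : 'I_n -> R) (rho : 'I_n -> 'M[R[i]]_(dA * dB)),
    [/\ forall z, 0 <= p z,
        \sum_z p z = 1,
        forall z, is_state (rho z) &
        (\sum_z (p z)%:E * E_kappa (rho z)
           < E_kappa (\sum_z (p z)%:C%C *: rho z)%R)%E].
Proof.
have h0 : 0 <= 2^-1 :> R by rewrite invr_ge0 ler0n.
have c0 : 0 <= 2^-1 :> R[i] by rewrite invr_ge0 ler0n.
exists 2, 2, 2, (fun=> 2^-1),
  (fun z => 2^-1 *: if z == 0 then bell R else dephased_bell R).
split=> [//||z|].
- by rewrite !big_ord_recl big_ord0 addr0; field.
- split; first by apply: psdmxZ => //; case: ifP => _;
    [exact: bell_psd | exact: dephased_bell_psd].
  rewrite mxtraceZ fun_if mxtrace_bell mxtrace_dephased_bell if_same.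
  by rewrite mulVf ?pnatr_eq0.
(* The factor 1/4 is the weight 1/2 times the normalisation 1/2. *)
have -> : \sum_(z < 2)
      (2^-1)%:C *: (2^-1 *: if z == 0 then bell R else dephased_bell R)
    = 4^-1 *: (bell R + dephased_bell R).
  rewrite !big_ord_recl big_ord0 addr0 /=.
  by rewrite fmorphV rmorph_nat -!scalerDr scalerA -invfM -natrM.
apply: (@le_lt_trans _ _ (2^-1)%:E).
  rewrite !big_ord_recl big_ord0 /=.
  move: (E_kappa_bell R) (E_kappa_dephased_bell R).
  move: (E_kappa _) (E_kappa _) => e1 e2 e1_le1 e2_le0.
  (* The bound 1/2 is rewritten as 1/2 * 1 + 1/2 * 0, to compare term by term in the extended
     reals. *)
  rewrite adde0 -[leRHS]adde0 -[X in (X + 0)%E]mule1.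
  rewrite -[X in (_ + X)%E](mule0 (2^-1)%:E).
  by apply: leeD; apply: lee_wpmul2l.
apply: (@lt_le_trans _ _ (log2 (3 / 2))%:E).
  by rewrite lte_fin half_lt_log2_3half.
apply/ereal_infP => _ [S Sf <-]; rewrite lee_fin.
have tS := kappa_feasible_mixture _ _ Sf.
(* Monotonicity of [ln] needs a positive trace, which [tS] also provides. *)
rewrite /log2 ler_pM2r ?invr_gt0 ?ln_gt0 ?ltr1n // ler_ln ?posrE //.
  exact: lt_le_trans tS.
Qed.
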